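(* Let $m\ge 2$, $n\ge 1$ and let $\mathcal{A}$ be a real $m$-order $n$-dimensional symmetric tensor. Let $$\gamma(\mathcal{A})=\min\{\mathcal{A}x^m:\ x\in\mathbb{R}^n,\ x\ge 0,\ \|x\|_m=1\}.$$ If $$\lambda(\mathcal{A})=\min\{\lambda:\ \lambda\text{ is a Pareto }H\text{-eigenvalue of }\mathcal{A}\},$$ then $\gamma(\mathcal{A})=\lambda(\mathcal{A})$.
   Context: An $m$-order $n$-dimensional real tensor is an array $\mathcal{A}=(a_{i_1\cdots i_m})$ of real numbers, $i_1,\ldots,i_m\in\{1,\ldots,n\}$; it is symmetric if its entries are invariant under any permutation of the indices. For $x\in\mathbb{R}^n$, $\mathcal{A}x^m=\sum_{i_1,\ldots,i_m=1}^n a_{i_1\cdots i_m}x_{i_1}\cdots x_{i_m}$, and $\mathcal{A}x^{m-1}\in\mathbb{R}^n$ is the vector with components $(\mathcal{A}x^{m-1})_i=\sum_{i_2,\ldots,i_m=1}^n a_{ii_2\cdots i_m}x_{i_2}\cdots x_{i_m}$. Write $x^{[m-1]}=(x_1^{m-1},\ldots,x_n^{m-1})^T$ and $\|x\|_m=(|x_1|^m+\cdots+|x_n|^m)^{1/m}$. Vector inequalities are componentwise. A real number $\lambda$ is a Pareto $H$-eigenvalue of $\mathcal{A}$ if there is a non-zero $x\in\mathbb{R}^n$ with $\mathcal{A}x^m=\lambda x^Tx^{[m-1]}$, $\mathcal{A}x^{m-1}-\lambda x^{[m-1]}\ge 0$ and $x\ge 0$. *)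

(* Defs.v *)
From mathcomp Require Import all_boot all_order all_fingroup all_algebra.
From mathcomp Require Import all_classical all_reals all_analysis.

Set Implicit Arguments.
Unset Strict Implicit.
Unset Printing Implicit Defensive.

Import Order.TTheory GRing.Theory Num.Theory.

Local Open Scope classical_set_scope.
Local Open Scope ring_scope.

Definition tensor (R : Type) (m n : nat) := m.-tuple 'I_n -> R.

Definition symmetric_tensor (R : Type) (m n : nat) (A : tensor R m n) : Prop :=
  forall (s : 'S_m) (t : m.-tuple 'I_n), A [tuple tnth t (s k) | k < m] = A t.

Section TensorOperations.
Variables (R : realType) (m n : nat).
Implicit Types (A : tensor R m n) (x : 'cV[R]_n).

Definition tensor_form A x : R :=
  \sum_(t : m.-tuple 'I_n) A t * \prod_(j <- t) x j ord0.

(* [A x^(m-1)]: in the [i]-th component, [t] ranges over the index tuples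
   [(i, i_2, ..., i_m)], and [behead t] is [(i_2, ..., i_m)]. *)
Definition tensor_apply A x : 'cV[R]_n :=
  \col_i \sum_(t : m.-tuple 'I_n | ohead t == Some i)
            A t * \prod_(j <- behead t) x j ord0.

End TensorOperations.

Definition hpower (R : realType) (n k : nat) (x : 'cV[R]_n) : 'cV[R]_n :=
  \col_i (x i ord0 ^+ k).

Definition nonneg_vec (R : realType) (n : nat) (x : 'cV[R]_n) : Prop :=
  forall i : 'I_n, 0 <= x i ord0.

Definition pnorm (R : realType) (m n : nat) (x : 'cV[R]_n) : R :=
  (\sum_(i < n) `|x i ord0| ^+ m) `^ (m%:R^-1).

Definition pareto_H_eigenvalue (R : realType) (m n : nat) (A : tensor R m n)
    (lambda : R) : Prop :=
  exists x : 'cV[R]_n,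
    [/\ x != 0,
        tensor_form A x = lambda * (x^T *m hpower m.-1 x) ord0 ord0,
        nonneg_vec (tensor_apply A x - lambda *: hpower m.-1 x)
      & nonneg_vec x].

Definition is_minimum (R : realType) (S : set R) (a : R) : Prop :=
  S a /\ lbound S a.

Definition form_values (R : realType) (m n : nat) (A : tensor R m n) : set R :=
  [set tensor_form A x | x in [set x | nonneg_vec x /\ pnorm m x = 1]].

(* Main.v *)
(* The minimum gamma is attained at some x, and by homogeneity
   A y^m >= gamma * sum_i y_i^m for all y >= 0. The polynomial in s given by
   the difference of the two sides at y = x + s e_i is nonnegative for s > 0 and
   vanishes at 0, so its derivative there, m ((A x^(m-1))_i - gamma x_i^(m-1)),
   is nonnegative: gamma is a Pareto H-eigenvalue. Conversely the inequality at
   an eigenvector bounds every Pareto H-eigenvalue below by gamma. *)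
Require Import Defs.
From mathcomp Require Import all_boot all_order all_fingroup all_algebra.
From mathcomp Require Import all_classical all_reals all_analysis.

Set Implicit Arguments.
Unset Strict Implicit.
Unset Printing Implicit Defensive.

Import Order.TTheory GRing.Theory Num.Theory.
Import numFieldNormedType.Exports.

Local Open Scope classical_set_scope.
Local Open Scope ring_scope.

(** Leibniz rule by induction on [r]; as [r] has no repetitions, the filter [l != k] drops exactly
    one factor. *)
Lemma deriv_prod (R : comNzRingType) (I : eqType) (r : seq I)
    (F : I -> {poly R}) : uniq r ->
  (\prod_(k <- r) F k)^`() =
  \sum_(k <- r) (F k)^`() * \prod_(l <- r | l != k) F l.
Proof.
elim: r => [|a r IH] /=; first by rewrite !big_nil derivC.
case/andP=> ar ur; rewrite !big_cons derivM IH // eqxx /=; congr (_ * _ + _).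
  rewrite [RHS]big_seq_cond [LHS]big_seq; apply: eq_bigl => l.
  by case: (boolP (l \in r)) => //= lr; apply/esym; apply: contraNneq ar => <-.
rewrite mulr_sumr; apply: eq_big_seq => k kr.
rewrite big_cons ifT; first by rewrite mulrCA.
by apply: contraNneq ar => ->.
Qed.

(** Since [p] vanishes at 0, $p = qX$ and $p'(0) = q(0)$, the right limit at 0 of $q(s) = p(s)/s \ge
    0$. *)
Lemma deriv0_ge0 (R : realType) (p : {poly R}) :
  p.[0] = 0 -> (forall s, 0 < s -> 0 <= p.[s]) -> 0 <= p^`().[0].
Proof.
move=> p0 ppos; have [q pE] : exists q, p = q * 'X.
  have /factor_theorem[q ->] : root p 0 by apply/rootP.
  by exists q; rewrite subr0.
rewrite pE derivM derivX mulr1 !hornerE.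
have qc : q.[s] @[s --> 0^'+] --> q.[0].
  by apply: cvg_at_right_filter; exact: continuous_horner.
rewrite -(cvg_lim _ qc) //; apply: limr_ge; first by apply/cvg_ex; exists q.[0].
near=> s; have s0 : 0 < s by near: s; exact: nbhs_right_gt.
by have := ppos _ s0; rewrite pE hornerMX pmulr_lge0.
Unshelve. all: by end_near. Qed.

Section TensorForms.
Variables (R : realType) (n : nat).
Implicit Types x y : 'cV[R]_n.

(** For $m > 0$ and $x \ge 0$ this is $\|x\|_m^m$; without absolute values and root it is a
    polynomial in [x]. *)
Definition power_sum (m : nat) x : R := \sum_i x i ord0 ^+ m.

Lemma dot_hpower m x : (0 < m)%N ->
  (x^T *m hpower m.-1 x) ord0 ord0 = power_sum m x.
Proof.
by case: m => // m _; rewrite mxE; apply: eq_bigr => i _; rewrite !mxE exprS.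
Qed.

Lemma power_sum_eq0 m x : nonneg_vec x -> power_sum m x = 0 -> x = 0.
Proof.
move=> x0 s0; apply/colP => i; rewrite mxE; apply/eqP.
have /eqP := s0; rewrite psumr_eq0; last by move=> j _; exact: exprn_ge0.
by move=> /allP /(_ i (mem_index_enum i)) /=; rewrite expf_eq0 => /andP[].
Qed.

Lemma power_sum_ge0 m x : nonneg_vec x -> 0 <= power_sum m x.
Proof. by move=> x0; apply: sumr_ge0 => i _; exact: exprn_ge0. Qed.

Lemma pnorm_powR m x : nonneg_vec x ->
  pnorm m x = power_sum m x `^ (m%:R^-1).
Proof.
move=> x0; rewrite /pnorm /power_sum; congr (_ `^ _).
by apply: eq_bigr => i _; rewrite ger0_norm.
Qed.

Lemma powR_invnK (m : nat) (a : R) : (0 < m)%N -> 0 <= a ->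
  (a `^ (m%:R^-1)) ^+ m = a.
Proof.
move=> m0 a0; rewrite -powR_mulrn ?powR_ge0// -powRrM mulVf ?powRr1//.
by rewrite pnatr_eq0 -lt0n.
Qed.

Lemma pnorm_eq1 m x : (0 < m)%N -> nonneg_vec x ->
  pnorm m x = 1 <-> power_sum m x = 1.
Proof.
move=> m0 x0; rewrite pnorm_powR //; split=> [h|->]; last by rewrite powR1.
by rewrite -(powR_invnK m0 (power_sum_ge0 m x0)) h expr1n.
Qed.

Lemma power_sumZ m r x : power_sum m (r *: x) = r ^+ m * power_sum m x.
Proof.
by rewrite /power_sum mulr_sumr; apply: eq_bigr => i _; rewrite mxE exprMn.
Qed.

Lemma tensor_formZ m (A : tensor R m n) r x :
  tensor_form A (r *: x) = r ^+ m * tensor_form A x.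
Proof.
rewrite /tensor_form mulr_sumr; apply: eq_bigr => t _.
rewrite mulrCA; congr (_ * _); rewrite !big_tuple.
under eq_bigr do rewrite mxE.
by rewrite big_split /= prodr_const card_ord.
Qed.

(** Continuity is stated on row vectors, the setting of the compactness and extreme value theorems
    applied below. *)
Lemma power_sum_tr_continuous m :
  continuous (fun v : 'rV[R]_n => power_sum m v^T).
Proof.
rewrite /power_sum; apply: continuous_big => [|i _]; first exact: add_continuous.
move=> v; under eq_fun do rewrite mxE.
apply: (@continuous_comp _ _ _ (fun v : 'rV[R]_n => v ord0 i)
  (fun r => r ^+ m)).
  exact: coord_continuous.
exact: exprn_continuous.
Qed.

Lemma tensor_form_tr_continuous m (A : tensor R m n) :
  continuous (fun v : 'rV[R]_n => tensor_form A v^T).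
Proof.
rewrite /tensor_form; apply: continuous_big => [|t _].
  exact: add_continuous.
move=> v; apply: continuousM; first exact: cst_continuous.
move: v; apply: continuous_big => [|i _]; first exact: mul_continuous.
by move=> v; under eq_fun do rewrite mxE; exact: coord_continuous.
Qed.

Lemma tensor_form_min m (A : tensor R m n) : (0 < m)%N -> (0 < n)%N ->
  exists x, [/\ nonneg_vec x, power_sum m x = 1 &
    forall y, nonneg_vec y -> power_sum m y = 1 ->
      tensor_form A x <= tensor_form A y].
Proof.
move=> m0 n0.
(* The nonnegative part of the unit sphere of the $m$-norm is [K], a closed subset of the compact
   cube [B]: each $y_i^m$ is at most the whole sum 1, so $y_i \le 1$. *)
pose B : set 'rV[R]_n := [set v | forall i, `[0, 1]%classic (v ord0 i)].
pose K := B `&` [set v | power_sum m v^T = 1].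
have KP y : nonneg_vec y -> power_sum m y = 1 -> K y^T.
  move=> y0 ys; split => /=; last by rewrite trmxK.
  move=> i; rewrite mxE /= in_itv /= y0 /=.
  rewrite -(@ler_pXn2r _ m) ?nnegrE // expr1n -ys /power_sum (bigD1 i) //=.
  by rewrite lerDl; apply: sumr_ge0 => j _; exact: exprn_ge0.
have cK : compact K.
  apply: compact_closedI.
    apply: (@rV_compact R n (fun=> `[0, 1]%classic)) => i.
    exact: segment_compact.
  rewrite [X in closed X](_ : _ =
    (fun v : 'rV[R]_n => power_sum m v^T) @^-1` [set 1]) //.
  apply: preimage_closed; last exact: closed_eq.
  by move=> v _; exact: power_sum_tr_continuous.
have K0 : K !=set0.
  pose e : 'cV[R]_n := \col_j (j == Ordinal n0)%:R.
  exists e^T; apply: KP => [i|]; first by rewrite mxE ler0n.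
  rewrite /power_sum (bigD1 (Ordinal n0)) //= mxE eqxx expr1n big1 ?addr0//.
  by move=> j /negbTE jn; rewrite mxE jn expr0n; case: (m) m0.
have [|c] := @EVT_min_rV R n (fun v => tensor_form A v^T) K K0 cK.
  exact/continuous_subspaceT/tensor_form_tr_continuous.
rewrite inE => -[cB cs] cmin; exists c^T; split => //.
  by move=> i; rewrite mxE; have := cB i; rewrite /= in_itv /= => /andP[].
by move=> y y0 ys; rewrite -[y]trmxK; apply: cmin; rewrite inE; exact: KP.
Qed.

(** Both sides are homogeneous of degree $m$, so a nonzero [y] can be rescaled to power sum 1. *)
Lemma tensor_form_ge m (A : tensor R m n) g : (0 < m)%N ->
  (forall y, nonneg_vec y -> power_sum m y = 1 -> g <= tensor_form A y) ->
  forall y, nonneg_vec y -> g * power_sum m y <= tensor_form A y.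
Proof.
move=> m0 gmin y y0; have s0 := power_sum_ge0 m y0.
have [sy|sy] := eqVneq (power_sum m y) 0.
  rewrite sy mulr0 (power_sum_eq0 y0 sy).
  (* Writing 0 as [0 *: 0] makes homogeneity produce the factor $0^m$, which is 0 because $m >
     0$. *)
  rewrite -[X in tensor_form A X](scale0r 0) tensor_formZ expr0n.
  by rewrite gtn_eqF // mul0r.
set S := power_sum m y in s0 sy *.
have Spos : 0 < S by rewrite lt_neqAle eq_sym sy.
pose r := S `^ (m%:R^-1); have rm : r ^+ m = S by exact: powR_invnK.
have rpos : 0 < r by exact: powR_gt0.
have := gmin (r^-1 *: y); rewrite power_sumZ tensor_formZ exprVn rm.
rewrite mulVf // mulrC ler_pdivlMr //; apply => // i.
by rewrite mxE mulr_ge0 // invr_ge0 ltW.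
Qed.

Definition line x (i j : 'I_n) : {poly R} := (x j ord0)%:P + (j == i)%:R *: 'X.

Lemma horner_line x i j s :
  (line x i j).[s] = (x + s *: delta_mx i ord0) j ord0.
Proof. by rewrite !mxE !hornerE mulrC. Qed.

Lemma deriv_line x i j : (line x i j)^`() = (j == i)%:R%:P.
Proof. by rewrite derivD derivC add0r derivZ derivX alg_polyC. Qed.

(** Swapping positions $k$ and 0 is an involution of the index tuples that preserves [A] and matches
    the tuples with $k$-th entry $i$ to those with head $i$. *)
Lemma apply_symmetric m (A : tensor R m.+1 n) x i k : symmetric_tensor A ->
  \sum_(t : m.+1.-tuple 'I_n | tnth t k == i)
    A t * \prod_(l | l != k) x (tnth t l) ord0 = tensor_apply A x i ord0.
Proof.
move=> hA; rewrite mxE.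
pose s := tperm k ord0.
pose f (t : m.+1.-tuple 'I_n) := [tuple tnth t (s l) | l < m.+1].
have fK : involutive f.
  by move=> t; apply: eq_from_tnth => l; rewrite !tnth_mktuple tpermK.
rewrite (reindex_inj (inv_inj fK)) /=; apply: eq_big => [t|t _].
  by rewrite tnth_mktuple tpermL; case/tupleP: t => h t; rewrite tnth0.
rewrite hA; congr (_ * _).
(* The same transposition, applied to the positions in the product, turns [l != k] into
   [l != ord0]. *)
rewrite (reindex_inj (@perm_inj _ s)) /=.
transitivity (\prod_(l | l != ord0) x (tnth t l) ord0).
  apply: eq_big => l; last by move=> _; rewrite tnth_mktuple tpermK.
  by rewrite -(inj_eq (@perm_inj _ s)) tpermK tpermL.
case/tupleP: t => h t; rewrite big_mkcond big_ord_recl /= mul1r big_tuple.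
by apply: eq_bigr => l _; rewrite tnthS.
Qed.

(* The index tuples contributing to the derivative through their k-th entry
   give (A x^(m-1))_i for every k, whence the factor m. *)
Lemma deriv_tensor_form m (A : tensor R m.+1 n) x i : symmetric_tensor A ->
  (\sum_t A t *: \prod_(k < m.+1) line x i (tnth t k))^`().[0] =
  tensor_apply A x i ord0 *+ m.+1.
Proof.
move=> hA; rewrite raddf_sum horner_sum.
transitivity (\sum_(k < m.+1) \sum_(t : m.+1.-tuple 'I_n | tnth t k == i)
    A t * \prod_(l | l != k) x (tnth t l) ord0); last first.
  under eq_bigr do rewrite apply_symmetric //.
  by rewrite sumr_const card_ord.
(* With the condition on [t] moved into the summand, the sums can be exchanged; for fixed [t] the
   product rule gives one term per position [k]. *)
under [RHS]eq_bigr do rewrite big_mkcond.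
rewrite exchange_big; apply: eq_bigr => t _ /=.
rewrite derivZ hornerZ deriv_prod ?index_enum_uniq // horner_sum mulr_sumr.
apply: eq_bigr => k _; rewrite deriv_line hornerM hornerC horner_prod.
case: eqP => _; rewrite ?mul0r ?mulr0 // mul1r; congr (_ * _).
by apply: eq_bigr => l _; rewrite horner_line scale0r addr0.
Qed.

Lemma deriv_power_sum m x i :
  (\sum_j line x i j ^+ m)^`().[0] = x i ord0 ^+ m.-1 *+ m.
Proof.
rewrite raddf_sum horner_sum (bigD1 i) //= big1 => [|j /negbTE ji].
  rewrite addr0 deriv_exp deriv_line eqxx mul1r hornerMn horner_exp horner_line.
  by rewrite scale0r addr0.
by rewrite deriv_exp deriv_line ji mul0r mul0rn horner0.
Qed.

Lemma minimizer_pareto m (A : tensor R m.+1 n) x : symmetric_tensor A ->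
  nonneg_vec x -> power_sum m.+1 x = 1 ->
  (forall y, nonneg_vec y ->
     tensor_form A x * power_sum m.+1 y <= tensor_form A y) ->
  pareto_H_eigenvalue A (tensor_form A x).
Proof.
move=> hA x0 sx xmin; exists x; split => //.
- apply/eqP => x00; have /eqP := sx; rewrite x00 /power_sum big1.
    by rewrite eq_sym oner_eq0.
  by move=> i _; rewrite mxE expr0n.
- by rewrite dot_hpower // sx mulr1.
move=> i; rewrite !mxE subr_ge0.
set g := tensor_form A x in xmin *.
pose p := \sum_t A t *: \prod_(k < m.+1) line x i (tnth t k)
          - g *: \sum_j line x i j ^+ m.+1.
have pE s : p.[s] = tensor_form A (x + s *: delta_mx i ord0)
                    - g * power_sum m.+1 (x + s *: delta_mx i ord0).
  rewrite /p hornerD hornerN hornerZ !horner_sum; congr (_ - _ * _).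
    apply: eq_bigr => t _; rewrite hornerZ horner_prod big_tuple.
    by congr (_ * _); apply: eq_bigr => k _; rewrite horner_line.
  by apply: eq_bigr => j _; rewrite horner_exp horner_line.
(* Only $s > 0$ surely keeps $x + s e_i$ nonnegative, so the first-order condition is an
   inequality. *)
have : 0 <= p^`().[0].
  apply: deriv0_ge0 => [|s s0]; first by rewrite pE scale0r addr0 sx mulr1 subrr.
  rewrite pE subr_ge0; apply: xmin => j.
  by rewrite !mxE addr_ge0 // mulr_ge0 ?ler0n // ltW.
(* Both derivatives carry the factor [m.+1], which cancels. *)
rewrite derivB hornerD hornerN derivZ hornerZ deriv_tensor_form //.
by rewrite deriv_power_sum subr_ge0 mulrnAr ler_pMn2r // mxE.
Qed.

(** At an eigenvector the form equals [l] times the power sum, which is positive for a nonzero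
    nonnegative vector and can be divided out. *)
Lemma pareto_ge m (A : tensor R m n) g l : (0 < m)%N ->
  (forall y, nonneg_vec y -> g * power_sum m y <= tensor_form A y) ->
  pareto_H_eigenvalue A l -> g <= l.
Proof.
move=> m0 gmin [x [xn0 fx _ x0]]; have := gmin x x0.
rewrite fx dot_hpower // ler_pM2r // lt_neqAle power_sum_ge0 // andbT eq_sym.
by apply: contraNneq xn0 => /(power_sum_eq0 x0) ->.
Qed.

End TensorForms.

Theorem theorem4p1 (R : realType) (m n : nat) (hm : (2 <= m)%N)
    (hn : (1 <= n)%N) (A : tensor R m n) (hA : symmetric_tensor A) :
  [/\ exists gamma : R, is_minimum (form_values A) gamma,
      exists lambda : R, is_minimum [set l | pareto_H_eigenvalue A l] lambda
    & forall gamma lambda : R,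
        is_minimum (form_values A) gamma ->
        is_minimum [set l | pareto_H_eigenvalue A l] lambda ->
        gamma = lambda].
Proof.
have m0 : (0 < m)%N by exact: ltnW.
have [x [x0 sx xmin]] := tensor_form_min A m0 hn.
have gmin := tensor_form_ge m0 xmin.
(* The single value [tensor_form A x] is the minimum of both sets; uniqueness of minima then gives
   the equality. *)
have min_form : is_minimum (form_values A) (tensor_form A x).
  split; first by exists x => //; split=> //; exact/pnorm_eq1.
  by move=> _ [y [y0 /pnorm_eq1 sy] <-]; apply: xmin => //; exact: sy.
have min_pareto :
    is_minimum [set l | pareto_H_eigenvalue A l] (tensor_form A x).
  split=> [|l]; last exact: pareto_ge.
  (* Order 0 is excluded by [hm], so the order is a successor, as [minimizer_pareto] requires. *)
  case: m A hA hm m0 x sx xmin gmin x0 {min_form} => // m A hA *.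
  exact: minimizer_pareto.
have min_uniq (S : set R) a b : is_minimum S a -> is_minimum S b -> a = b.
  by move=> [Sa la] [Sb lb]; apply/eqP; rewrite eq_le la //= lb.
split; [by exists (tensor_form A x)..|].
by move=> g l /min_uniq/(_ min_form)-> /min_uniq/(_ min_pareto)->.
Qed.
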